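(* If a graph does not contain a long wheel as a subgraph, then it is 4-colorable.
   Context: Graphs are finite, simple and undirected. A wheel in a graph $G$ consists of a cycle $C$ of $G$ (as a subgraph, not necessarily induced; called the rim) and a vertex $v\in V(G)\setminus V(C)$ (the center) having at least three neighbors in $V(C)$. A long wheel is a wheel whose rim is a cycle of length at least 4. *)

(* Defs.v *)
From mathcomp Require Import all_boot.

Set Implicit Arguments.
Unset Strict Implicit.
Unset Printing Implicit Defensive.

(* A finite simple graph is a symmetric irreflexive adjacency relation on a
   finite type of vertices. *)
Definition simple_graph (T : finType) (e : rel T) : Prop :=
  symmetric e /\ irreflexive e.

(* The size bound is needed: [ucycle e] also holds of the empty sequence and
   of the two ends of a single edge. *)
Definition graph_cycle (T : finType) (e : rel T) (c : seq T) : bool :=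
  (3 <= size c) && ucycleb e c.

Definition neighbors_in (T : finType) (e : rel T) (v : T) (c : seq T) :
  {set T} := [set u in c | e v u].

Definition wheel (T : finType) (e : rel T) (c : seq T) (v : T) : bool :=
  [&& graph_cycle e c, v \notin c & 3 <= #|neighbors_in e v c|].

Definition long_wheel (T : finType) (e : rel T) (c : seq T) (v : T) : bool :=
  wheel e c v && (4 <= size c).

Definition has_long_wheel (T : finType) (e : rel T) : Prop :=
  exists (c : seq T) (v : T), long_wheel e c v.

Definition colorable (T : finType) (e : rel T) (k : nat) : Prop :=
  exists f : T -> 'I_k, forall x y : T, e x y -> f x != f y.

(* Main.v *)
Require Import Defs.
From mathcomp Require Import all_boot.
From Stdlib Require Import Classical.

(* A graph in which every vertex has degree at least 4 contains a long wheel;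
   greedy coloring then concludes.  To be closed under cutting along two
   vertices, the degree claim allows two exceptional roots x, y, equal or
   adjacent, which may not be the center.  A counterexample with the fewest
   vertices is 3-connected as far as pieces free of x and y are concerned,
   since such a piece, with its two attachments joined by an edge and taken as
   roots, is a smaller instance.  Maximizing a connected set containing the
   roots while a cycle survives outside gives a chordless cycle C avoiding the
   roots with H = U \ C connected.  If H has no cut vertex, take v in C with
   neighbours n, m on C: a path of H from a neighbour of m to a neighbour of n
   through a neighbour of v closes the path C \ v to the rim of a wheel
   centered at v.  Otherwise some cut vertex b of H separates a set A (a lobe)
   from the roots; choosing C and A with |A| minimal, A contains a good cycle
   C2, and a lobe of C2 leads to a lobe smaller than A. *)

Set Implicit Arguments.
Unset Strict Implicit.
Unset Printing Implicit Defensive.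

(** * Paths, connected sets and cycles as vertex sets *)

Section Paths.

Variables (T : finType) (e : rel T).
Implicit Types (a b c d h p q u v w z : T) (A B C R S X Y Z : {set T}).

(* [spath a S b]: [S] is the vertex set of a simple path from [a] to [b]. *)
Inductive spath : T -> {set T} -> T -> Prop :=
| Spath1 a : spath a [set a] a
| SpathS a c S b : e a c -> a \notin S -> spath c S b -> spath a (a |: S) b.

(** Connectedness without paths: a failure directly yields a proper part closed under adjacency. The
    empty set counts as connected. *)
Definition conn X := forall Z, Z \subset X -> Z != set0 ->
  (forall u v, u \in Z -> v \in X -> e u v -> v \in Z) -> X \subset Z.

(** A cycle, possibly with chords, is remembered only through its vertex set; the bound excludes a
    single edge. *)
Definition cyc C := exists a b, [/\ spath a C b, e b a & 2 < #|C|].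

Lemma spath_src a S b : spath a S b -> a \in S.
Proof. by case=> *; rewrite !inE eqxx. Qed.

Lemma spath_tgt a S b : spath a S b -> b \in S.
Proof. by elim=> *; rewrite !inE ?eqxx //; apply/orP; right. Qed.

Lemma spath_inv a S b : spath a S b -> (a = b /\ S = [set a]) \/
  exists c S', [/\ e a c, a \notin S', S = a |: S' & spath c S' b].
Proof.
by case=> [a'|a' c S' b' eac nS pS]; [left|right; exists c, S'].
Qed.

Lemma spath_cat a S b c S' d :
  spath a S b -> e b c -> spath c S' d -> (forall z, z \in S -> z \notin S') ->
  spath a (S :|: S') d.
Proof.
move=> pS; elim: pS c S' d => [{}a|{}a c' {}S {}b eac nS pS IH] c S' d ebc pS' dis.
  by apply: SpathS ebc _ pS'; apply: dis; rewrite inE.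
rewrite -setUA; apply: SpathS eac _ _.
  by rewrite inE negb_or nS dis // !inE eqxx.
by apply: IH ebc pS' _ => z zS; apply: dis; rewrite !inE zS orbT.
Qed.

Lemma spath_join a S b S' d :
  spath a S b -> spath b S' d -> (forall z, z \in S -> z \in S' -> z = b) ->
  spath a (S :|: S') d.
Proof.
move=> pS pS' dis; have bS := spath_tgt pS.
have bsS : S :|: [set b] = S by apply/setUidPl; rewrite sub1set.
case: (spath_inv pS') => [[<- ->]|[c [S2 [ebc nb eS p2]]]].
  by rewrite bsS.
have -> : S :|: S' = S :|: S2.
  by rewrite eS setUA bsS.
apply: (spath_cat pS ebc p2) => z zS; apply/negP => zS2.
have zb : z = b by apply: dis => //; rewrite eS !inE zS2 orbT.
by move: nb; rewrite -zb zS2.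
Qed.

Lemma spath_split a S b h : spath a S b -> h \in S ->
  exists S1 S2, [/\ spath a S1 h, spath h S2 b, S = S1 :|: S2 &
    forall z, z \in S1 -> z \in S2 -> z = h].
Proof.
elim=> [{}a|{}a c {}S {}b eac nS pS IH].
  rewrite inE => /eqP ->; exists [set a], [set a]; split; rewrite ?setUid //; try exact: Spath1.
  by move=> z; rewrite inE => /eqP.
case: (eqVneq h a) => [-> _|hna].
  exists [set a], (a |: S); split; first exact: Spath1.
  - exact: SpathS eac nS pS.
  - by rewrite setUA setUid.
  - by move=> z; rewrite inE => /eqP.
rewrite !inE (negPf hna) /= => /IH[S1 [S2 [p1 p2 eS dis]]].
have := nS; rewrite eS inE negb_or => /andP[n1 n2].
exists (a |: S1), S2; split => //; first exact: SpathS eac n1 p1.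
  by rewrite setUA.
move=> z; rewrite !inE => /orP[/eqP->|]; last exact: dis.
by rewrite (negPf n2).
Qed.

Lemma spath_first a S b Y : spath a S b -> b \in Y ->
  exists w S', [/\ spath a S' w, S' \subset S, w \in Y &
    forall z, z \in S' -> z \in Y -> z = w].
Proof.
elim=> [{}a aY|{}a c {}S {}b eac nS pS IH bY].
  exists a, [set a]; split=> //; first exact: Spath1.
  by move=> z; rewrite inE => /eqP.
case: (boolP (a \in Y)) => aY.
  exists a, [set a]; split=> //; first exact: Spath1.
    by rewrite sub1set !inE eqxx.
  by move=> z; rewrite inE => /eqP.
have [w [S' [p' sS wY dis]]] := IH bY; exists w, (a |: S'); split=> //.
- by apply: SpathS eac _ p'; apply: contra nS; apply: (subsetP sS).
- exact: setUS.
move=> z; rewrite !inE => /orP[/eqP->|]; last exact: dis.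
by rewrite (negPf aY).
Qed.

Lemma spath_loop a S : spath a S a -> S = [set a].
Proof.
move=> pS; case: (spath_inv pS) => [[]//|[c [S' [_ nS _ p']]]].
by move: nS; rewrite (spath_tgt p').
Qed.

(** The vertices reachable from [a] inside [X] form a closed subset, hence all of [X]. *)
Lemma conn_ind X (Q : T -> Prop) a : conn X -> a \in X -> Q a ->
  (forall u v, u \in X -> v \in X -> Q u -> e u v -> Q v) ->
  forall b, b \in X -> Q b.
Proof.
move=> cX aX Qa Qs b bX.
pose r := [rel u v | [&& u \in X, v \in X & e u v]].
have: b \in [set u in X | connect r a u].
  apply: (subsetP (cX _ _ _ _)) bX.
  - by apply/subsetP=> z; rewrite inE => /andP[].
  - by apply/set0Pn; exists a; rewrite inE aX connect0.
  move=> u v; rewrite !inE => /andP[uX cu] vX euv; rewrite vX /=.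
  by apply: connect_trans cu (connect1 _); rewrite /= uX vX.
rewrite inE bX => /connectP[s ps ->] {b bX}.
elim: s a aX Qa ps => //= c s IH a aX Qa /andP[/and3P[_ cX' eac]].
exact/IH/(Qs a).
Qed.

Lemma conn_spath X a b : conn X -> a \in X -> b \in X ->
  exists2 S, spath a S b & S \subset X.
Proof.
move=> cX aX.
apply: (conn_ind (Q := fun b => exists2 S, spath a S b & S \subset X) cX aX).
  by exists [set a]; rewrite ?sub1set //; apply: Spath1.
move=> u v uX vX [S pS sS] euv; case: (boolP (v \in S)) => vS.
  have [S1 [S2 [p1 _ eS _]]] := spath_split pS vS; exists S1 => //.
  by apply: subset_trans sS; rewrite eS subsetUl.
exists (S :|: [set v]); last by rewrite subUset sS sub1set.
apply: (spath_cat pS euv (Spath1 v)) => z zS; rewrite inE.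
by apply: contraNneq vS => <-.
Qed.

Lemma notconn X : ~ conn X -> exists Z, [/\ Z \subset X, Z != set0,
  (forall u v, u \in Z -> v \in X -> e u v -> v \in Z) & ~~ (X \subset Z)].
Proof.
move=> nX; apply: NNPP => nZ; apply: nX => Z sZ Z0 cZ.
by case: (boolP (X \subset Z)) => // nXZ; case: nZ; exists Z.
Qed.

(** A closed subset that meets one of the two sets contains it, and the edge carries it over to the
    other. *)
Lemma connU X Y u v : conn X -> conn Y -> u \in X -> v \in Y -> e u v -> e v u ->
  conn (X :|: Y).
Proof.
move=> cX cY uX vY euv evu Z sZ nZ cZ.
have half X' : conn X' -> X' \subset X :|: Y -> Z :&: X' != set0 -> X' \subset Z.
  move=> cX' sX' nX'; apply: subset_trans (subsetIl Z X').
  apply: cX' => //; first exact: subsetIr.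
  move=> s t; rewrite !inE => /andP[sZ' sX''] tX' est; rewrite tX' andbT.
  by apply: cZ sZ' _ est; apply: (subsetP sX').
have hX := half _ cX (subsetUl _ _); have hY := half _ cY (subsetUr _ _).
have XY : X \subset Z -> Y \subset Z.
  move=> XZ; apply: hY; apply/set0Pn; exists v; rewrite inE vY andbT.
  by apply: cZ euv; [apply: (subsetP XZ) | rewrite inE vY orbT].
have YX : Y \subset Z -> X \subset Z.
  move=> YZ; apply: hX; apply/set0Pn; exists u; rewrite inE uX andbT.
  by apply: cZ evu; [apply: (subsetP YZ) | rewrite inE uX].
have [z zZ] := set0Pn _ nZ.
rewrite subUset; have := subsetP sZ z zZ; rewrite inE => /orP[zX|zY].
  have XZ : X \subset Z by apply: hX; apply/set0Pn; exists z; rewrite inE zZ.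
  by rewrite XZ XY.
have YZ : Y \subset Z by apply: hY; apply/set0Pn; exists z; rewrite inE zZ.
by rewrite YZ YX.
Qed.

Lemma conn1 a : conn [set a].
Proof. by move=> Z; rewrite subset1 => /orP[/eqP->//|->]. Qed.

Lemma spath_conn (symE : symmetric e) a S b : spath a S b -> conn S.
Proof.
elim=> [{}a|{}a c {}S {}b eac nS pS IH]; first exact: conn1.
by apply: (connU (u := a) (v := c)) => //; [exact: conn1 | rewrite inE | exact: spath_src pS | rewrite symE].
Qed.

Hypotheses (symE : symmetric e) (irrE : irreflexive e).

Lemma spath_rev a S b : spath a S b -> spath b S a.
Proof.
elim=> [{}a|{}a c {}S {}b eac nS pS IH]; first exact: Spath1.
rewrite setUC; apply: (spath_cat IH _ (Spath1 a)); first by rewrite symE.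
by move=> z zS; rewrite inE; apply: contraNneq nS => <-.
Qed.

(* The set of vertices [h] lying on some simple path from [p] to [q] is closed
   under adjacency: if [h'] is a neighbour of [h], a path from [h'] avoiding
   [h] reaches the given path elsewhere and gives a detour through [h']. *)
Lemma spath_via B p q h : conn B -> (forall w, w \in B -> conn (B :\ w)) ->
  p \in B -> q \in B -> p != q -> h \in B ->
  exists S, [/\ spath p S q, S \subset B & h \in S].
Proof.
move=> cB c2 pB qB npq.
pose Q h := exists S, [/\ spath p S q, S \subset B & h \in S].
apply: (conn_ind (Q := Q) cB pB).
  have [S pS sS] := conn_spath cB pB qB.
  by exists S; split=> //; apply: spath_src pS.
move=> {}h h' hB h'B [S [pS sS hS]] ehh'.
case: (boolP (h' \in S)) => h'S; first by exists S.
have nh : h' != h by apply: contraNneq h'S => ->.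
have [w0 w0S nw0] : exists2 w0, w0 \in S & w0 != h.
  case: (eqVneq p h) => [<-|ph]; last by exists p => //; apply: spath_src pS.
  by exists q; [apply: spath_tgt pS | rewrite eq_sym].
have h'B1 : h' \in B :\ h by rewrite !inE nh.
have w0B1 : w0 \in B :\ h by rewrite !inE nw0 (subsetP sS).
have [R0 pR0 sR0] := conn_spath (c2 h hB) h'B1 w0B1.
have [w [R [pR sRR wS dR]]] := spath_first pR0 w0S.
have sR := subset_trans sRR sR0.
have hR : h \notin R by apply/negP => /(subsetP sR); rewrite !inE eqxx.
have wR := spath_tgt pR.
have nwh : w != h by apply: contraNneq hR => <-.
have h'R := spath_src pR.
have RB : R \subset B by apply: subset_trans sR (subsetDl _ _).
have phR : spath h (h |: R) w by apply: SpathS ehh' hR pR.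
(* Reversing the path exchanges its two halves, so [w] may be assumed to lie on the half after
   [h]. *)
suff detour p0 q0 : spath p0 S q0 ->
    (exists S1 S2, [/\ spath p0 S1 h, spath h S2 q0, S = S1 :|: S2,
      (forall z, z \in S1 -> z \in S2 -> z = h) & w \in S2]) ->
    exists S', [/\ spath p0 S' q0, S' \subset B & h' \in S'].
  have [S1 [S2 [p1 p2 eS dS]]] := spath_split pS hS.
  have := wS; rewrite {1}eS inE => /orP[w1|w2].
    case: (detour q p); first exact: spath_rev.
      exists S2, S1; split; rewrite 1?setUC //; try exact: spath_rev.
      by move=> z z2 z1; apply: dS.
    by move=> S' [? ? ?]; exists S'; split=> //; apply: spath_rev.
  by apply: detour pS _; exists S1, S2.
move=> _ [S1 [S2 [p1 p2 eS dS wS2]]].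
have [S3 [S4 [p3 p4 eS2 dS2]]] := spath_split p2 wS2.
have inS z : z \in S1 \/ z \in S2 -> z \in S.
  by rewrite eS inE => -[->|->] //; rewrite orbT.
have in4 z : z \in S4 -> z \in S2 by rewrite eS2 inE orbC => ->.
(* The detour follows the old path to [h], leaves through [h'], returns at [w] and skips what lay
   between. *)
exists (S1 :|: (h |: R) :|: S4); split.
- apply: (spath_join (spath_join p1 phR _) p4) => z.
    move=> z1; rewrite !inE => /orP[/eqP//|zR].
    have zw : z = w by apply: dR => //; apply: inS; left.
    by apply: dS => //; rewrite zw.
  rewrite !inE => /orP[z1|/orP[/eqP zh|zR]] z4.
  + have zh : z = h by apply: dS => //; apply: in4.
    by apply: dS2 z4; rewrite zh; apply: spath_src p3.
  + by apply: dS2 z4; rewrite zh; apply: spath_src p3.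
  + by apply: dR => //; apply: inS; right; apply: in4.
- rewrite !subUset sub1set hB RB !andbT.
  by apply/andP; split; apply: subset_trans sS; apply/subsetP=> z ?; apply: inS; [left|right; apply: in4].
- by rewrite !inE h'R !orbT.
Qed.

(** Rotation of the cycle: the part from [v] on, the closing edge, then the part before [v]. *)
Lemma cyc_start C v : cyc C -> v \in C -> exists2 b, spath v C b & e b v.
Proof.
move=> [a [b [pC eba _]]] vC.
have [S1 [S2 [p1 p2 eC dC]]] := spath_split pC vC.
case: (spath_inv (spath_rev p1)) => [[va eS]|[m [S' [evm nv eS p']]]].
  by exists b; rewrite va.
exists m; last by rewrite symE.
have -> : C = S2 :|: S'.
  rewrite eC eS; apply/setP => z; rewrite !inE; have vS2 := spath_src p2.
  by case: eqP => [->|_]; rewrite ?vS2 ?orbT //= orbC.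
apply: (spath_cat p2 eba (spath_rev p')) => z z2; apply/negP => zS'.
have zv : z = v by apply: dC; rewrite // eS !inE zS' orbT.
by move: nv; rewrite -zv zS'.
Qed.

(** The form in which cycles are mostly used below: the path left by deleting [v] can be closed up
    differently. *)
Lemma cyc_open C v : cyc C -> v \in C -> exists n S m,
  [/\ C = v |: S, v \notin S, spath n S m & [/\ e v n, e v m & n != m]].
Proof.
move=> cC vC; have [b pC ebv] := cyc_start cC vC; have [_ [_ [_ _ C3]]] := cC.
case: (spath_inv pC) => [[_ eC]|[n [S [evn vS eC pS]]]].
  by move: C3; rewrite eC cards1.
exists n, S, b; split=> //; split=> //; first by rewrite symE.
apply: contraTneq C3 => nb; rewrite nb in pS *.
by rewrite eC (spath_loop pS) -leqNgt cardsU1 cards1; case: (_ \notin _).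
Qed.

Lemma cyc_close v n S m : spath n S m -> v \notin S -> e v n -> e v m -> n != m ->
  cyc (v |: S).
Proof.
move=> pS vS evn evm nm; exists v, m; split; first exact: SpathS evn vS pS.
  by rewrite symE.
have nS := spath_src pS; have mS := spath_tgt pS.
apply/card_gt2P; exists v, n, m; rewrite !inE eqxx nS mS !orbT nm.
by split=> //; split=> //; [apply: contraNneq vS => -> | apply: contraNneq vS => <-].
Qed.

Lemma card_gt1_other A p : 1 < #|A| -> exists2 u, u \in A & u != p.
Proof.
case/card_gt1P=> u [v [uA vA uv]]; case: (eqVneq u p) => [up|]; last by exists u.
by exists v => //; rewrite -up eq_sym.
Qed.

Lemma card_gt2_other A p q : 2 < #|A| -> exists u, [/\ u \in A, u != p & u != q].
Proof.
rewrite (cardsD1 q) => h.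
have : 1 < #|A :\ q| by case: (q \in A) h => //= /ltnW.
case/(card_gt1_other p) => u; rewrite !inE => /andP[uq uA] up.
by exists u.
Qed.

(** A third neighbour of [c] on the cycle gives a chord, which cuts off a cycle on fewer
    vertices. *)
Lemma cyc_chordless C : cyc C -> exists C', [/\ cyc C', C' \subset C &
  forall c, c \in C' -> #|[set u in C' | e c u]| <= 2].
Proof.
have [k] := ubnP #|C|; elim: k C => // k IH C kC cC.
case: (boolP [forall c in C, #|[set u in C | e c u]| <= 2]) => [/forall_inP h|].
  by exists C.
case/forall_inPn => c cC0; rewrite -ltnNge.
have [n [S [m [eC cS pS [ecn ecm nm]]]]] := cyc_open cC cC0.
case/(card_gt2_other n m) => d; rewrite inE => -[/andP[dC ecd] dn dm].
have dS : d \in S.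
  by move: dC; rewrite eC !inE => /orP[/eqP dc|//]; rewrite dc irrE in ecd.
have [S1 [S2 [p1 p2 eS dS12]]] := spath_split pS dS.
have cS1 : c \notin S1 by apply: contra cS; rewrite eS inE => ->.
have mS1 : m \notin S1.
  by apply: contra dm => m1; rewrite eq_sym (dS12 m m1 (spath_tgt p2)).
have nd : n != d by rewrite eq_sym.
have cC1 := cyc_close p1 cS1 ecn ecd nd.
have sub : c |: S1 \subset C by rewrite eC setUS // eS subsetUl.
have mC : m \in C by rewrite eC !inE (spath_tgt pS) orbT.
have pr : c |: S1 \proper C.
  apply/properP; split=> //; exists m => //; rewrite !inE negb_or mS1 andbT.
  by apply: contraTneq ecm => ->; rewrite irrE.
have [|C' [c' sC' h]] := IH (c |: S1) _ cC1.
  by rewrite -ltnS; apply: leq_trans kC; rewrite ltnS proper_card.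
by exists C'; split=> //; apply: subset_trans sC' sub.
Qed.

(* A longest path has an end other than [x0], all of whose neighbours lie on
   the path. *)
Lemma cyc_of_mindeg R x0 r0 : r0 \in R -> r0 != x0 ->
  (forall r, r \in R -> r != x0 -> 1 < #|[set u in R | e r u]|) ->
  exists2 C, cyc C & C \subset R.
Proof.
move=> r0R r0x deg.
suff main k a S b : #|R :\: S| < k -> spath a S b -> S \subset R ->
    a != x0 -> exists2 C, cyc C & C \subset R.
  by apply: (main _ r0 [set r0] r0 (ltnSn _)) => //; [apply: Spath1 | rewrite sub1set].
elim: k a S b => // k IH a S b hk pS sS ax.
have aS := spath_src pS; have := deg a (subsetP sS a aS) ax.
case: (boolP [exists c in (R :\: S), e a c]) => [/exists_inP[c cRS eac] _|/exists_inPn nex].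
  have := cRS; rewrite inE => /andP[cS cR].
  have pc : spath c (c |: S) b by apply: SpathS pS => //; rewrite symE.
  have sc : c |: S \subset R by rewrite subUset sub1set cR.
  have hc : #|R :\: (c |: S)| < k.
    rewrite -ltnS; apply: leq_trans hk; rewrite ltnS; apply: proper_card; apply/properP; split.
      by apply: setDS; apply: subsetUr.
    by exists c => //; rewrite !inE eqxx.
  (* If the path has just reached [x0], it is grown from its other end, which lay on the path before
     and so differs from [x0]. *)
  have [cx|cx] := eqVneq c x0; last exact: IH hc pc sc cx.
  have bx : b != x0 by rewrite -cx; apply: contraNneq cS => <-; apply: spath_tgt pS.
  by apply: IH (spath_rev pc) sc bx.
have nbS w : w \in R -> e a w -> w \in S.
  by move=> wR eaw; apply: contraLR eaw => wS; apply: nex; rewrite inE wS.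
case: (spath_inv pS) => [[_ eS]|[n [S' [ean aS' eS pS']]]].
  case/(card_gt1_other a) => u; rewrite inE => /andP[uR eau].
  by have := nbS u uR eau; rewrite eS inE => ->.
case/(card_gt1_other n) => d; rewrite inE => /andP[dR ead] dn.
have := nbS d dR ead; rewrite eS !inE => /orP[/eqP da|dS'].
  by rewrite da irrE in ead.
have [S1 [S2 [p1 _ eS' _]]] := spath_split pS' dS'.
exists (a |: S1); last by apply: subset_trans sS; rewrite eS setUS // eS' subsetUl.
apply: cyc_close p1 _ ean ead _; last by rewrite eq_sym.
by apply: contra aS'; rewrite eS' inE => ->.
Qed.

(** Equal or adjacent roots cannot be separated, so one of the two sides of a separation of [X]
    misses both. *)
Lemma disconnected_piece X x y : ~ conn X -> x = y \/ e x y ->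
  exists Z, [/\ Z \subset X, Z != set0, x \notin Z /\ y \notin Z,
    (forall u v, u \in Z -> v \in X -> e u v -> v \in Z) &
    exists2 o, o \in X & o \notin Z].
Proof.
move=> /notconn[Z [sZ nZ cZ /subsetPn[o oX oZ]]] xy.
have [/andP[xZ yZ]|hxy] := boolP ((x \notin Z) && (y \notin Z)).
  by exists Z; split=> //; exists o.
have xyX : (x \in X -> x \in Z) /\ (y \in X -> y \in Z).
  case: xy => [xy|exy].
    by subst y; move: hxy; rewrite andbb negbK => xZ; split.
  move: hxy; rewrite negb_and !negbK => /orP[xZ|yZ]; split=> // hX.
    exact: cZ xZ hX exy.
  by apply: cZ yZ hX _; rewrite symE.
have [z zZ] := set0Pn _ nZ.
exists (X :\: Z); split; first exact: subsetDl.
- by apply/set0Pn; exists o; rewrite inE oZ.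
- by case: xyX => hx hy; rewrite !inE; split; apply/negP => /andP[/negP nz /[dup] hX]; [move/hx|move/hy].
- move=> u v; rewrite !inE => /andP[uZ uX] vX euv; rewrite vX andbT.
  by apply: contra uZ => vZ; apply: cZ vZ uX _; rewrite symE.
- by exists z; [apply: (subsetP sZ) | rewrite inE zZ].
Qed.

(** The first path is left where it first meets the second, which is followed from there on. *)
Lemma spath_glue a S b S' c : spath a S b -> spath b S' c ->
  exists2 W, spath a W c & W \subset S :|: S'.
Proof.
move=> pS pS'; have [w [S1 [p1 s1 wS' d1]]] := spath_first pS (spath_src pS').
have [S2 [S3 [_ p3 eS' _]]] := spath_split pS' wS'.
have s3 : S3 \subset S' by rewrite eS' subsetUr.
exists (S1 :|: S3); last exact: setUSS.
by apply: (spath_join p1 p3) => z z1 z3; apply: d1 => //; apply: (subsetP s3).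
Qed.

End Paths.

(** * Paths and cycles under a change of adjacency *)

Section Transfer.

Variables (T : finType) (e e' : rel T).
Implicit Types (a b : T) (C S : {set T}).

Lemma spath_transfer a S b : spath e' a S b ->
  (forall u v, u \in S -> v \in S -> e' u v -> e u v) -> spath e a S b.
Proof.
elim=> [{}a|{}a c {}S {}b eac aS pS IH] h; first exact: Spath1.
have cS := spath_src pS.
apply: (@SpathS _ e a c S b _ aS); first by apply: h; rewrite ?inE ?eqxx ?cS ?orbT.
by apply: IH => u v uS vS euv; apply: h; rewrite ?inE ?uS ?vS ?orbT.
Qed.

Lemma cyc_transfer C : cyc e' C ->
  (forall u v, u \in C -> v \in C -> e' u v -> e u v) -> cyc e C.
Proof.
move=> [a [b [pC eba C3]]] h; exists a, b; split=> //; first exact: spath_transfer.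
by apply: h eba; [apply: spath_tgt pC | apply: spath_src pC].
Qed.

End Transfer.

(** * Rooted instances and the absence of small cuts in a minimal counterexample *)

Section Wheels.

Variable T : finType.
Implicit Types (e : rel T) (a b c d h p q u v w x y z : T) (A B C R S U X Y Z : {set T}).

(* A cycle is represented by its vertex set, [x] and [y] may lie on the rim. *)
Definition has_rooted_wheel e x y := exists C v,
  [/\ cyc e C, 3 < #|C|, v \notin C, v != x /\ v != y &
      2 < #|[set u in C | e v u]|].

(** Instances live on a subset of a fixed type, so that a piece of a graph is again an instance.
    [rooted_ex] excludes graphs made of the roots alone, where the degree condition is empty. *)
Record rooted e U x y : Prop := Rooted {
  rooted_sym : symmetric e;
  rooted_irr : irreflexive e;
  rooted_in : forall a b, e a b -> a \in U;
  rooted_x : x \in U;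
  rooted_y : y \in U;
  rooted_xy : x = y \/ e x y;
  rooted_ex : exists z, [/\ z \in U, z != x & z != y];
  rooted_deg : forall z, z \in U -> z != x -> z != y ->
    3 < #|[set u | e z u]| }.

Section Minimal.

Variables (e : rel T) (U : {set T}) (x y : T).
Hypothesis rU : rooted e U x y.
Hypothesis noW : ~ has_rooted_wheel e x y.
Hypothesis minU : forall e' U' x' y', #|U'| < #|U| -> rooted e' U' x' y' ->
  has_rooted_wheel e' x' y'.

Let symE := rooted_sym rU.
Let irrE := rooted_irr rU.
Let xU := rooted_x rU.
Let yU := rooted_y rU.
Let xy := rooted_xy rU.

Lemma edge_in a b : e a b -> a \in U /\ b \in U.
Proof. by move=> eab; split; [| rewrite symE in eab]; apply: rooted_in rU _ _ eab. Qed.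

Lemma root_free_neq Z z : x \notin Z -> y \notin Z -> z \in Z -> z != x /\ z != y.
Proof. by move=> xZ yZ zZ; split; apply: contraTneq zZ => ->. Qed.

(* The smaller instance is [Z] with its attachments [p] and [q], joined by a
   new edge when distinct; a path through the rest replaces this edge if the
   rim uses it. *)
Lemma cut_bypass Z p q :
  Z != set0 -> Z \subset U -> x \notin Z -> y \notin Z ->
  p \in U :\: Z -> q \in U :\: Z ->
  (forall u v, u \in Z -> e u v -> v \in [set p; q] :|: Z) ->
  (exists2 o, o \in U & o \notin [set p; q] :|: Z) ->
  (p != q -> exists2 W, spath e p W q & [disjoint W & Z]) -> False.
Proof.
move=> nZ sZ xZ yZ; rewrite !inE => /andP[pZ pU] /andP[qZ qU] cZ [o oU oZ] byp.
pose U' := [set p; q] :|: Z.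
pose e' := [rel a b | [&& a \in U', b \in U' & e a b ||
   (p != q) && ((a == p) && (b == q) || (a == q) && (b == p))]].
have pU' : p \in U' by rewrite !inE eqxx.
have qU' : q \in U' by rewrite !inE eqxx orbT.
have ZU' z : z \in Z -> z \in U' by move=> zZ; rewrite !inE zZ orbT.
have symE' : symmetric e'.
  move=> a b /=; rewrite symE andbCA; congr [&& _, _ & _ || _ && _].
  by rewrite orbC andbC [X in _ || X]andbC.
have irrE' : irreflexive e'.
  move=> a; apply/negP => /and3P[_ _]; rewrite irrE /= => /andP[npq].
  by case/orP=> /andP[/eqP h1 /eqP h2]; move: npq; rewrite -h1 -h2 eqxx.
have rU' : rooted e' U' p q.
  split=> //.
  - by move=> a b /andP[].
  - case: (eqVneq p q) => pq; [by left | right].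
    by rewrite /= pU' qU' pq !eqxx orbT.
  - have [z zZ] := set0Pn _ nZ; exists z; split; first exact: ZU'.
      by apply: contraNneq pZ => <-.
    by apply: contraNneq qZ => <-.
  move=> z; rewrite !inE => /orP[/orP[/eqP->|/eqP->]|zZ]; rewrite ?eqxx // => zp zq.
  have [zx zy] := root_free_neq xZ yZ zZ.
  apply: leq_trans (rooted_deg rU (subsetP sZ z zZ) zx zy) _.
  apply: subset_leq_card; apply/subsetP => u; rewrite !inE => ezu.
  have uU' : u \in U' := cZ z u zZ ezu.
  by apply/and3P; split; [exact: ZU' | | rewrite ezu].
have ltU : #|U'| < #|U|.
  apply: proper_card; apply/properP; split; last by exists o.
  by rewrite !subUset !sub1set pU qU.
have [C [v [cC C4 vC [vp vq] v3]]] := minU ltU rU'.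
have e'e u w : (u != p) && (w != p) || (u != q) && (w != q) -> e' u w -> e u w.
  rewrite /= => h /and3P[_ _ /orP[//|/andP[_]]].
  by case/orP: h => /andP[/negPf-> /negPf->]; rewrite ?andbF.
have vZ : v \in Z.
  have /card_gt0P[u] : 0 < #|[set u in C | e' v u]| by apply: leq_trans v3.
  by rewrite !inE (negPf vp) (negPf vq) => /andP[_ /andP[]].
have [vx vy] := root_free_neq xZ yZ vZ.
(* The center differs from [p] and [q], so its edges are edges of [e]; only the rim has to be
   rerouted. *)
suff [C' [cC' sC vC']] : exists C', [/\ cyc e C', C \subset C' & v \notin C'].
  apply: noW; exists C', v; split=> //.
    by apply: leq_trans C4 _; apply: subset_leq_card.
  apply: leq_trans v3 _; apply: subset_leq_card; apply/subsetP => u.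
  rewrite !inE => /andP[uC evu]; rewrite (subsetP sC) //=.
  by case/and3P: evu => _ _; rewrite (negPf vp) (negPf vq) andbF orbF.
have CU' : C \subset U'.
  apply/subsetP => z zC; have [n [_ [_ [_ _ _ [ezn _ _]]]]] := cyc_open symE' cC zC.
  by case/andP: ezn.
have e'q w : e' p w -> w != q -> e p w.
  have [pq|pq] := eqVneq p q; last by move=> epw wq; apply: e'e epw; rewrite pq wq orbT.
  by case/and3P=> _ _; rewrite pq eqxx /= orbF.
(* The new edge joins [p] to [q], so a set missing one of them sees only edges of [e]. *)
have avoid r S : r \in [set p; q] -> r \notin S ->
    forall u w, u \in S -> w \in S -> e' u w -> e u w.
  move=> hr rS u w uS wS; apply: e'e.
  have nr z : z \in S -> z != r by move=> zS; apply: contraNneq rS => <-.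
  by move: hr nr; rewrite !inE => /orP[]/eqP-> nr; rewrite !nr // orbT.
have [pC|pC] := boolP (p \in C); last first.
  exists C; split=> //; apply: cyc_transfer cC _; apply: (avoid p) => //.
  by rewrite !inE eqxx.
have [qC|qC] := boolP (q \in C); last first.
  exists C; split=> //; apply: cyc_transfer cC _; apply: (avoid q) => //.
  by rewrite !inE eqxx orbT.
have [n [S [m [eC pS pSnm [epn epm nm]]]]] := cyc_open symE' cC pC.
have p1 : spath e n S m.
  by apply: spath_transfer pSnm _; apply: (avoid p); rewrite // !inE eqxx.
have vS : v \notin S by apply: contra vC; rewrite eC !inE => ->; rewrite orbT.
(* When [q] is next to [p] on the rim, [W] replaces the edge between them. It meets the rim only in
   [p] and [q], because it avoids [Z]. *)
have toq S0 m0 : spath e q S0 m0 -> S0 = S -> e' p m0 -> q != m0 ->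
    exists C', [/\ cyc e C', C \subset C' & v \notin C'].
  move=> pq0 eS0 epm0 qm0; subst S0.
  have pq : p != q by apply: contraNneq pS => ->; apply: spath_src pq0.
  have [W pW dW] := byp pq.
  have pWS : spath e p (W :|: S) m0.
    apply: (spath_join pW pq0) => z zW zS.
    have zC : z \in C by rewrite eC !inE zS orbT.
    have := subsetP CU' z zC; rewrite !inE => /orP[/orP[/eqP zp|/eqP//]|zZ].
      by move: pS; rewrite -zp zS.
    by have := disjointFr dW zW; rewrite zZ.
  have sC : C \subset W :|: S by rewrite eC setSU // sub1set (spath_src pW).
  exists (W :|: S); split=> //.
    exists p, m0; split=> //; last by apply: leq_trans (subset_leq_card sC); apply: ltnW.
    by rewrite symE; apply: e'q epm0 _; rewrite eq_sym.
  by rewrite inE negb_or vS andbT; apply/negP => vW; have := disjointFr dW vW; rewrite vZ.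
case: (eqVneq n q) => [nq|nq].
  by subst n; apply: (toq S m).
case: (eqVneq m q) => [mq|mq].
  by subst m; apply: (toq S n) => //; [apply: spath_rev | rewrite eq_sym].
exists C; split=> //; rewrite eC; apply: cyc_close p1 pS _ _ nm => //.
  exact: e'q epn nq.
exact: e'q epm mq.
Qed.

(** A cut vertex is the case of equal attachments, where [cut_bypass] asks for no path. *)
Lemma conn_minus w : w \in U -> conn e (U :\ w).
Proof.
move=> wU; apply: NNPP => /(disconnected_piece symE)/(_ xy).
case=> Z [sZ nZ [xZ yZ] cZ [o oU oZ]].
have wZ : w \notin Z by apply/negP => /(subsetP sZ); rewrite !inE eqxx.
apply: (@cut_bypass Z w w) => //.
- by apply: subset_trans sZ _; apply: subD1set.
- by rewrite inE wZ.
- by rewrite inE wZ.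
- move=> u v uZ euv; rewrite !inE orbb; case: eqVneq => //= vw.
  by apply: (cZ u) => //; rewrite !inE vw; case: (edge_in euv).
- exists o; first by move: oU; rewrite !inE => /andP[].
  by move: oU; rewrite !inE negb_or orbb oZ => /andP[->].
- by rewrite eqxx.
Qed.

(** A closed part missing the roots has no attachment; one of its vertices is taken out to serve as
    both. *)
Lemma conn_all : conn e U.
Proof.
apply: NNPP => /(disconnected_piece symE)/(_ xy).
case=> Z [sZ nZ [xZ yZ] cZ _]; have [z zZ] := set0Pn _ nZ.
have [zx zy] := root_free_neq xZ yZ zZ; have zU := subsetP sZ z zZ.
apply: (@cut_bypass (Z :\ z) z z).
- have /card_gt0P[u] : 0 < #|[set u | e z u]|.
    by apply: leq_trans (rooted_deg rU zU zx zy).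
  rewrite inE => ezu; apply/set0Pn; exists u; rewrite !inE.
  rewrite (cZ z u zZ _ ezu) ?andbT; last by case: (edge_in ezu).
  by apply: contraTneq ezu => ->; rewrite irrE.
- by apply: subset_trans sZ; apply: subD1set.
- by rewrite !inE negb_and xZ orbT.
- by rewrite !inE negb_and yZ orbT.
- by rewrite !inE eqxx.
- by rewrite !inE eqxx.
- move=> u v; rewrite !inE => /andP[_ uZ] euv; case: eqVneq => //= _.
  by apply: (cZ u) => //; case: (edge_in euv).
- by exists x => //; rewrite !inE negb_or orbb eq_sym zx negb_and xZ orbT.
- by rewrite eqxx.
Qed.

(** A path from [o] to [p] that avoids [q], stopped when it first meets [p |: Z], ends at [p], since
    [Z] can be entered only through [p] or [q]. *)
Lemma path_avoiding Z p q o : p \in U -> p \notin Z -> q \in U -> p != q ->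
  (forall u v, u \in Z -> e u v -> v \in [set p; q] :|: Z) ->
  o \in U -> o \notin [set p; q] :|: Z ->
  exists2 W, spath e o W p & [disjoint W & Z].
Proof.
move=> pU pZ qU pq cZ oU; rewrite !inE !negb_or => /andP[/andP[op oq] oZ].
have oB : o \in U :\ q by rewrite !inE oq.
have pB : p \in U :\ q by rewrite !inE pq.
have [S pS sS] := conn_spath (conn_minus qU) oB pB.
have pY : p \in p |: Z by rewrite !inE eqxx.
have [w [S' [pS' sS' wY dS']]] := spath_first pS pY.
have wp : w = p.
  case: (spath_inv (spath_rev symE pS')) => [[wo _]|[c [S1 [ewc wS1 eS p1]]]].
    by move: wY; rewrite !inE wo (negPf op) (negPf oZ).
  move: (wY); rewrite !inE => /orP[/eqP//|wZ].
  have cS' : c \in S' by rewrite eS !inE (spath_src p1) orbT.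
  have cq : c != q.
    by have := subsetP sS _ (subsetP sS' _ cS'); rewrite !inE => /andP[].
  have := cZ w c wZ ewc; rewrite !inE (negPf cq) orbF => cY.
  have cw : c = w by apply: dS' => //; rewrite !inE.
  by move: wS1; rewrite -cw (spath_src p1).
subst w; exists S' => //; rewrite disjoints_subset; apply/subsetP=> z zS'.
rewrite inE; apply/negP => zZ.
have zp : z = p by apply: dS' => //; rewrite !inE zZ orbT.
by move: pZ; rewrite -zp zZ.
Qed.

(** Paths avoiding [Z] from an outside vertex [o] to [p] and to [q] combine into the bypass. *)
Lemma no_2cut Z p q :
  Z != set0 -> Z \subset U -> x \notin Z -> y \notin Z ->
  p \in U :\: Z -> q \in U :\: Z ->
  (forall u v, u \in Z -> e u v -> v \in [set p; q] :|: Z) ->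
  (exists2 o, o \in U & o \notin [set p; q] :|: Z) -> False.
Proof.
move=> nZ sZ xZ yZ pUZ qUZ cZ [o oU oZ].
apply: (cut_bypass nZ sZ xZ yZ pUZ qUZ cZ); first by exists o.
move: pUZ qUZ; rewrite !inE => /andP[pZ pU] /andP[qZ qU] pq.
have [W1 p1 d1] := path_avoiding pU pZ qU pq cZ oU oZ.
have [W2 p2 d2] : exists2 W, spath e o W q & [disjoint W & Z].
  apply: (path_avoiding (q := p)) => //; first by rewrite eq_sym.
    by move=> u v uZ euv; rewrite [[set _; _]]setUC; apply: cZ euv.
  by rewrite [[set _; _]]setUC.
have [W pW sW] := spath_glue (spath_rev symE p1) p2.
by exists W => //; rewrite disjoints_subset; apply: subset_trans sW _; rewrite subUset -!disjoints_subset d1.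
Qed.

End Minimal.
End Wheels.

(** * Good cycles and their lobes *)

Section Lobes.

Variables (T : finType) (e : rel T) (U : {set T}) (x y : T).
Implicit Types (a b c d h m n p q u v w z : T) (A C D R S W X Y Z : {set T}).
Hypothesis rU : rooted e U x y.
Hypothesis noW : ~ has_rooted_wheel e x y.
Hypothesis minU : forall (e' : rel T) (U' : {set T}) x' y', #|U'| < #|U| -> rooted e' U' x' y' ->
  has_rooted_wheel e' x' y'.

Let symE := rooted_sym rU.
Let irrE := rooted_irr rU.
Let xU := rooted_x rU.
Let yU := rooted_y rU.
Let xy := rooted_xy rU.

Record good C : Prop := Good {
  good_cyc : cyc e C;
  good_x : x \notin C;
  good_y : y \notin C;
  good_conn : conn e (U :\: C);
  good_chordless : forall c, c \in C -> #|[set u in C | e c u]| <= 2 }.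

Lemma cyc_sub C : cyc e C -> C \subset U.
Proof.
move=> cC; apply/subsetP => v vC.
have [n [_ [_ [_ _ _ [evn _ _]]]]] := cyc_open symE cC vC.
by case: (edge_in rU evn).
Qed.

Lemma few_rim_nbrs C z : cyc e C -> 3 < #|C| -> z \notin C -> z != x -> z != y ->
  #|[set u in C | e z u]| <= 2.
Proof.
move=> cC C4 zC zx zy; rewrite leqNgt; apply/negP => h.
by apply: noW; exists C, z.
Qed.

(** Of at least four neighbours, at most two lie on the chordless cycle. *)
Lemma good_outer C c : good C -> c \in C -> 1 < #|[set u in U :\: C | e c u]|.
Proof.
move=> gC cC; have [cx cy] := root_free_neq (good_x gC) (good_y gC) cC.
have cU := subsetP (cyc_sub (good_cyc gC)) c cC.
have h4 := rooted_deg rU cU cx cy.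
have : #|[set u | e c u]| <= #|[set u in C | e c u]| + #|[set u in U :\: C | e c u]|.
  rewrite -cardsUI; apply: leq_trans (leq_addr _ _).
  apply: subset_leq_card; apply/subsetP => u; rewrite !inE => ecu.
  by rewrite ecu (proj2 (edge_in rU ecu)) !andbT orbN.
move=> h; have := leq_trans h4 h; have := good_chordless gC cC.
case: #|[set u in C | e c u]| => [|[|[|//]]] _ //=; rewrite ?add0n ?add1n ?add2n ?ltnS //.
  by move/ltnW/ltnW.
by move/ltnW.
Qed.

(** By chordlessness [n] is one of the two cycle neighbours of [v], so the path can be made to start
    there. *)
Lemma good_open C v n : good C -> v \in C -> n \in C -> e v n -> exists S m,
  [/\ C = v |: S, v \notin S, spath e n S m & [/\ e v m, n != m & m \in C]].
Proof.
move=> gC vC nC evn.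
have [n0 [S [m0 [eC vS pS [evn0 evm0 nm]]]]] := cyc_open symE (good_cyc gC) vC.
have n0C : n0 \in C by rewrite eC !inE (spath_src pS) orbT.
have m0C : m0 \in C by rewrite eC !inE (spath_tgt pS) orbT.
have e2 : [set n0; m0] = [set u in C | e v u].
  apply/eqP; rewrite eqEcard cards2 nm (good_chordless gC vC) andbT.
  by apply/subsetP => u; rewrite !inE => /orP[]/eqP->; apply/andP.
have : n \in [set n0; m0] by rewrite e2 inE nC.
rewrite !inE => /orP[]/eqP ->; first by exists S, m0.
by exists S, n0; split=> //; [apply: spath_rev | rewrite eq_sym].
Qed.

(* Enlarge [X] while a cycle survives outside it: when this stops, every
   neighbour of [X] lies on all the cycles avoiding [X], so that the vertices
   outside [X] and a chordless cycle induce a forest, a leaf of which has three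
   neighbours on the cycle. *)
Lemma good_exists X C : conn e X -> X \subset U -> x \in X -> y \in X ->
  cyc e C -> C \subset U :\: X -> exists2 C', good C' & C' \subset U :\: X.
Proof.
have [k] := ubnP #|U :\: X|; elim: k X C => // k IH X C hk cX sX xX yX cC sC.
have [[r [C' [[rU' rX] [s sX' esr] cC' sC']]]|hN] := classic (exists r C',
    [/\ r \in U /\ r \notin X, exists2 s, s \in X & e s r, cyc e C' &
        C' \subset U :\: (r |: X)]).
  have [|||||C2 g2 s2] := IH (r |: X) C' _ _ _ _ _ cC' sC'.
  - rewrite -ltnS; apply: leq_trans hk; rewrite ltnS; apply: proper_card.
    apply/properP; split; first by apply: setDS; apply: subsetUr.
    by exists r; rewrite !inE ?rX ?eqxx.
  - by apply: (connU (u := r) (v := s)) => //; [apply: conn1 | rewrite inE | rewrite symE].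
  - by rewrite subUset sub1set rU'.
  - by rewrite inE xX orbT.
  - by rewrite inE yX orbT.
  by exists C2 => //; apply: subset_trans s2 _; apply: setDS; apply: subsetUr.
have [C1 [cC1 sC1 ch1]] := cyc_chordless symE irrE cC.
have s1 := subset_trans sC1 sC.
have C1X z : z \in C1 -> z \notin X.
  by move/(subsetP s1); rewrite inE => /andP[].
suff eX : U :\: C1 = X.
  exists C1 => //; split=> //; last by rewrite eX.
    by apply: contraL xX; apply: C1X.
  by apply: contraL yX; apply: C1X.
have avoid r s D : r \in U -> r \notin X -> s \in X -> e s r -> cyc e D ->
    D \subset U :\: X -> r \in D.
  move=> rU' rX sX' esr cD sD; apply/negPn/negP => rD; apply: hN.
  exists r, D; split=> //; first by exists s.
  apply/subsetP => z zD; have := subsetP sD z zD; rewrite !inE => /andP[zX zU].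
  by rewrite negb_or zX zU !andbT; apply: contraNneq rD => <-.
have [r [s [rU' rX sX' esr]]] : exists r s, [/\ r \in U, r \notin X, s \in X & e s r].
  apply: NNPP => nrs; have : U \subset X.
    apply: (conn_all rU noW minU) sX _ _; first by apply/set0Pn; exists x.
    move=> u v uX vU euv; apply/negPn/negP => vX; apply: nrs; by exists v, u.
  have [a [b [pC _ _]]] := cC => /subsetP UX.
  by have := subsetP sC _ (spath_src pC); rewrite inE => /andP[/negP aX /UX].
have rC1 : r \in C1 by apply: avoid esr cC1 s1.
pose R := (U :\: X) :\: C1.
have [R0|[z0 z0R]] := set_0Vmem R.
  apply/setP=> z; apply/idP/idP; rewrite inE.
    case/andP=> zC1 zU; apply/negPn/negP => zX.
    by have := in_set0 z; rewrite -R0 !inE zC1 zX zU.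
  by move=> zX; rewrite (subsetP sX) // andbT; apply: contraL zX; apply: C1X.
have [v [vR vdeg]] : exists v, v \in R /\ #|[set u in R | e v u]| <= 1.
  apply: NNPP => nv.
  have z0x : z0 != x.
    by apply: contraTneq z0R => ->; rewrite !inE xX andbF.
  have [t tR _|D cD sD] := cyc_of_mindeg symE irrE z0R z0x.
    by rewrite ltnNge; apply/negP => ht; apply: nv; exists t.
  have rD : r \in D.
    by apply: avoid esr cD _ => //; apply: subset_trans sD (subsetDl _ _).
  by have := subsetP sD r rD; rewrite inE rC1.
move: (vR); rewrite !inE => /and3P[vC1 vX vU].
have vx : v != x by apply: contraNneq vX => ->.
have vy : v != y by apply: contraNneq vX => ->.
have d3 : 2 < #|[set u in C1 | e v u]|.
  have h4 := rooted_deg rU vU vx vy.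
  have : #|[set u | e v u]| <= #|[set u in R | e v u]| + #|[set u in C1 | e v u]|.
    rewrite -cardsUI; apply: leq_trans (leq_addr _ _).
    apply: subset_leq_card; apply/subsetP => u; rewrite !inE => evu.
    rewrite evu (proj2 (edge_in rU evu)) !andbT.
    suff -> : u \notin X by rewrite andbT orNb.
    by apply/negP => uX; move: vC1; rewrite (avoid v u C1) // symE.
  move=> h; rewrite -(leq_add2l 1); apply: leq_trans h4 _; apply: leq_trans h _.
  by rewrite leq_add2r.
(* A longer rim would give a wheel, so [C1] is a triangle joined completely to [v]. Exchanging [r]
   for [v] then gives a cycle that misses both [X] and [r]. *)
have C3 : #|C1| <= 3.
  rewrite leqNgt; apply/negP => C4.
  by have := few_rim_nbrs cC1 C4 vC1 vx vy; rewrite leqNgt d3.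
have full : [set u in C1 | e v u] = C1.
  apply/eqP; rewrite eqEcard (leq_trans C3 d3) andbT.
  by apply/subsetP => u; rewrite inE => /andP[].
have adj u : u \in C1 -> e v u by rewrite -{1}full inE => /andP[].
have [n [S [m [eC rS pS [ern erm nm]]]]] := cyc_open symE cC1 rC1.
have inS u : u \in S -> u \in C1 by rewrite eC !inE orbC => ->.
have vS : v \notin S by apply: contra vC1; apply: inS.
have cD := cyc_close symE pS vS (adj _ (inS _ (spath_src pS)))
  (adj _ (inS _ (spath_tgt pS))) nm.
have sD : v |: S \subset U :\: X.
  rewrite subUset sub1set !inE vX vU /=; apply/subsetP => u /inS uC1.
  exact: (subsetP s1).
have := avoid r s _ rU' rX sX' esr cD sD.
rewrite !inE (negPf rS) orbF => /eqP rv.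
by move: vC1; rewrite -rv rC1.
Qed.

(* The rim is [C] without [v], followed by [W]. *)
Lemma rim_wheel C v n S m p q W h : good C -> C = v |: S -> v \notin S ->
  spath e n S m -> e v n -> e v m -> n != m ->
  spath e p W q -> W \subset U :\: C -> e m p -> e q n -> p != q ->
  h \in W -> e v h -> False.
Proof.
move=> gC eC vS pS evn evm nm pW sW emp eqn pq hW evh.
have WC z : z \in W -> z \notin C by move/(subsetP sW); rewrite inE => /andP[].
have SC z : z \in S -> z \in C by rewrite eC !inE orbC => ->.
have vC : v \in C by rewrite eC !inE eqxx.
have nS := spath_src pS; have mS := spath_tgt pS.
have dis : S :&: W = set0.
  apply/setP => z; rewrite !inE; apply/negP => /andP[zS zW].
  by have := WC z zW; rewrite SC.
have [vx vy] := root_free_neq (good_x gC) (good_y gC) vC.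
have card2 X a b : a \in X -> b \in X -> a != b -> 1 < #|X|.
  by move=> aX bX ab; apply/card_gt1P; exists a, b.
have c4 : 3 < #|S :|: W|.
  rewrite cardsU dis cards0 subn0 -[4]/(2 + 2).
  by apply: leq_add; [apply: card2 nm | apply: card2 pq => //; [apply: spath_src pW | apply: spath_tgt pW]].
apply: noW; exists (S :|: W), v; split=> //.
- exists n, q; split=> //; last exact: ltnW.
  apply: (spath_cat pS emp pW) => z zS; apply: contraL (SC z zS); exact: WC.
- by rewrite inE negb_or vS; apply: contraL vC; apply: WC.
apply/card_gt2P; exists n, m, h; rewrite !inE nS mS hW evn evm evh orbT nm.
split=> //; split=> //.
  by apply: contraTneq hW => <-; apply: contraL (SC m mS); apply: WC.
by apply: contraTneq hW => ->; apply: contraL (SC n nS); apply: WC.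
Qed.

Lemma good_not_2conn C : good C ->
  ~ (forall w, w \in U :\: C -> conn e ((U :\: C) :\ w)).
Proof.
move=> gC c2; have [v [b [pC _ _]]] := good_cyc gC.
have vC := spath_src pC.
have [n [S [m [eC vS pS [evn evm nm]]]]] := cyc_open symE (good_cyc gC) vC.
have nC : n \in C by rewrite eC !inE (spath_src pS) orbT.
have mC : m \in C by rewrite eC !inE (spath_tgt pS) orbT.
have [h] := card_gt1_other v (good_outer gC vC).
rewrite !inE => /andP[hH evh] _.
have [q] := card_gt1_other v (good_outer gC nC).
rewrite !inE => /andP[qH enq] _.
have [p] := card_gt1_other q (good_outer gC mC).
rewrite !inE => /andP[pH emp] pq.
have [|||W [pW sW hW]] := spath_via symE (p := p) (q := q) (h := h) (good_conn gC) c2 _ _ pq.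
- by rewrite inE.
- by rewrite inE.
- by rewrite inE.
by apply: (rim_wheel gC eC vS pS evn evm nm pW sW emp _ pq hW evh); rewrite symE.
Qed.

(** A nonempty union of root-free components left when [b] is removed outside the cycle; [b] itself
    may be a root. *)
Record lobe C b A : Prop := Lobe {
  lobe_b : b \in U :\: C;
  lobe_n0 : A != set0;
  lobe_sub : A \subset (U :\: C) :\ b;
  lobe_x : x \notin A;
  lobe_y : y \notin A;
  lobe_nbr : forall u v, u \in A -> v \in U :\: C -> e u v -> v \in b |: A }.

Definition min_lobe C b A :=
  lobe C b A /\ forall b' A', lobe C b' A' -> #|A| <= #|A'|.

Lemma lobe_piece C w X : w \in U :\: C -> X \subset (U :\: C) :\ w -> X != set0 ->
  x \notin X -> y \notin X ->
  (forall u v, u \in X -> v \in (U :\: C) :\ w -> e u v -> v \in X) -> lobe C w X.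
Proof.
move=> wH sX nX xX yX cX; split=> // u v uX vH euv; rewrite in_setU1.
by case: eqVneq => //= vw; apply: cX euv; rewrite // in_setD1 vw.
Qed.

Lemma exists_lobe C : good C -> exists b A, lobe C b A.
Proof.
move=> gC; apply: NNPP => nl; apply: (good_not_2conn gC) => w wH.
apply: NNPP => /(disconnected_piece symE)/(_ xy)[Z [sZ nZ [xZ yZ] cZ _]].
by apply: nl; exists w, Z; apply: lobe_piece.
Qed.

Lemma exists_min_lobe C b A : lobe C b A ->
  exists b' A', min_lobe C b' A' /\ #|A'| <= #|A|.
Proof.
have [k] := ubnP #|A|; elim: k b A => // k IH b A hk lA.
have [[b1 [A1 [l1 h1]]]|hN] := classic (exists b1 A1, lobe C b1 A1 /\ #|A1| < #|A|).
  have [b2 [A2 [m2 h2]]] := IH b1 A1 (leq_trans h1 hk) l1.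
  by exists b2, A2; split=> //; apply: leq_trans h2 (ltnW h1).
exists b, A; split=> //; split=> // b' A' l'.
by rewrite leqNgt; apply/negP => h; apply: hN; exists b', A'.
Qed.

(** * Structure of a smallest lobe of a good cycle *)

Section MinLobe.

Variables (C A : {set T}) (b : T).
Hypotheses (gC : good C) (mA : min_lobe C b A).

Local Notation H := (U :\: C).

Let lA := proj1 mA.
Let bH : b \in H := lobe_b lA.

Lemma lobe_in a : a \in A -> a \in H /\ a != b.
Proof. by move/(subsetP (lobe_sub lA)); rewrite in_setD1 => /andP[]. Qed.

Let AH : A \subset H.
Proof. by apply/subsetP => a /lobe_in[]. Qed.

Let bA : b \notin A.
Proof. by apply/negP => /lobe_in[_]; rewrite eqxx. Qed.

Let AC a : a \in A -> a \notin C.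
Proof. by move/(subsetP AH); rewrite inE => /andP[]. Qed.

(** Off the cycle, neighbours of [A] stay in [b |: A], so closedness need only be checked there. *)
Lemma sub_lobe w X : w \in b |: A -> X \subset A :\ w -> X != set0 ->
  (forall u v, u \in X -> v \in (b |: A) :\ w -> e u v -> v \in X) ->
  lobe C w X.
Proof.
move=> wB sX nX cX; have XA : X \subset A := subset_trans sX (subD1set _ _).
have wH : w \in H by move: wB; rewrite in_setU1 => /orP[/eqP->//|/(subsetP AH)].
apply: lobe_piece => //.
- exact: subset_trans sX (setSD _ AH).
- by apply: contra (lobe_x lA); apply: (subsetP XA).
- by apply: contra (lobe_y lA); apply: (subsetP XA).
move=> u v uX; rewrite in_setD1 => /andP[vw vH] euv; apply: cX (euv) => //.
by rewrite in_setD1 vw; apply: (lobe_nbr lA) euv; first exact: (subsetP XA).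
Qed.

(** A proper closed part of [A] would be a smaller lobe at [b]. *)
Lemma lobe_conn : conn e A.
Proof.
move=> X sX nX cX; suff lX : lobe C b X.
  have := proj2 mA _ _ lX => le; suff -> : X = A by [].
  by apply/eqP; rewrite eqEcard sX.
apply: sub_lobe => //; rewrite ?in_setU1 ?eqxx //; last first.
  by move=> u v uX; rewrite in_setD1 in_setU1 => /andP[/negPf->] /=; apply: cX.
by apply/subsetP => z zX; have zA := subsetP sX z zX; rewrite in_setD1 zA; case: (lobe_in zA) => _ ->.
Qed.

Lemma lobe_conn_root : conn e (b |: A).
Proof.
have [/exists_inP[a aA eba]|/exists_inPn nb] := boolP [exists a in A, e b a].
  apply: (connU (u := b) (v := a)) => //; first exact: conn1; first exact: lobe_conn.
    by rewrite inE.
  by rewrite symE.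
(* Without an edge to [b], the set [A] would be closed in the connected [H] and so contain [b]. *)
have := good_conn gC AH (lobe_n0 lA) => /(_ _)/subsetP hA.
case/negP: bA; apply: hA => // u v uA vH euv.
have := lobe_nbr lA uA vH euv; rewrite in_setU1 => /orP[/eqP vb|//].
by have := nb u uA; rewrite symE -vb euv.
Qed.

(** If a vertex [w] of [A] separated this set, a piece missing [b] would be a smaller lobe at
    [w]. *)
Lemma lobe_2conn w : w \in b |: A -> conn e ((b |: A) :\ w).
Proof.
rewrite in_setU1 => /orP[/eqP->|wA].
  have -> : (b |: A) :\ b = A; last exact: lobe_conn.
  by rewrite setU1K.
have [wH wb] := lobe_in wA.
apply: NNPP => /(disconnected_piece symE (x := b) (y := b))/(_ (or_introl erefl)).
case=> X [sX nX [bX _] cX _].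
have XAw : X \subset A :\ w.
  apply/subsetP => z zX; have := subsetP sX z zX; rewrite !inE => /andP[-> /orP[/eqP zb|//]].
  by rewrite -zb zX in bX.
have lX : lobe C w X by apply: sub_lobe => //; rewrite in_setU1 wA orbT.
have := proj2 mA _ _ lX; rewrite leqNgt => /negP; apply.
apply: proper_card; apply/properP; split; first exact: subset_trans XAw (subD1set _ _).
by exists w => //; apply/negP => /(subsetP XAw); rewrite in_setD1 eqxx.
Qed.

(** A closed part containing [b] becomes closed in [H] once [A] is added. One without [b] is already
    closed in [H], as [A] is attached only at [b]; then it is all of [H], a contradiction. *)
Lemma lobe_compl_conn : conn e (H :\: A).
Proof.
move=> Z sZ nZ cZ; have ZH : Z \subset H := subset_trans sZ (subsetDl _ _).
have ZA z : z \in Z -> z \notin A by move/(subsetP sZ); rewrite in_setD => /andP[].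
have [bZ|bZ] := boolP (b \in Z).
  suff HZA : H \subset Z :|: A.
    apply/subsetP => z; rewrite in_setD => /andP[zA /(subsetP HZA)].
    by rewrite in_setU (negPf zA) orbF.
  apply: (good_conn gC); first by rewrite subUset ZH.
    by apply/set0Pn; exists b; rewrite in_setU bZ.
  move=> u v; rewrite !in_setU => /orP[uZ|uA] vH euv.
    have [vA|vA] := boolP (v \in A); first by rewrite orbT.
    by rewrite (cZ u v) // in_setD vA.
  have := lobe_nbr lA uA vH euv; rewrite in_setU1 => /orP[/eqP->|->]; rewrite ?bZ //.
  by rewrite orbT.
have : H \subset Z; last by move/subsetP/(_ b bH) => bZ'; rewrite bZ' in bZ.
apply: (good_conn gC) => // u v uZ vH euv; apply: cZ (uZ) _ (euv).
rewrite in_setD vH andbT; apply/negP => vA.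
have uH := subsetP ZH u uZ; rewrite symE in euv.
have := lobe_nbr lA vA uH euv; rewrite in_setU1 (negPf (ZA u uZ)) orbF => /eqP ub.
by rewrite -ub uZ in bZ.
Qed.

(** Within [b |: A] this is [spath_via]; a start elsewhere is first joined to [b] outside the
    lobe. *)
Lemma lobe_path p q h : p \in H -> q \in A -> h \in A -> p != q ->
  exists W, [/\ spath e p W q, W \subset H & h \in W].
Proof.
move=> pH qA hA pq.
have BH : b |: A \subset H by rewrite subUset sub1set bH.
have inB z : z \in A -> z \in b |: A by rewrite in_setU1 orbC => ->.
have [pB|] := boolP (p \in b |: A).
  have [W [pW sW hW]] := spath_via symE lobe_conn_root lobe_2conn pB (inB q qA) pq (inB h hA).
  by exists W; split=> //; apply: subset_trans sW BH.
rewrite in_setU1 negb_or => /andP[pb pA].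
have bq : b != q by rewrite eq_sym; case: (lobe_in qA).
have [W [pW sW hW]] := spath_via symE lobe_conn_root lobe_2conn (setU11 b A) (inB q qA) bq (inB h hA).
have [||S pS sS] := conn_spath lobe_compl_conn (a := p) (b := b).
- by rewrite in_setD pA.
- by rewrite in_setD bA.
exists (S :|: W); split.
- apply: (spath_join pS pW) => z zS /(subsetP sW).
  by have := subsetP sS z zS; rewrite in_setD in_setU1 => /andP[/negPf-> _]; rewrite orbF => /eqP.
- rewrite subUset (subset_trans sW BH) andbT.
  by apply: subset_trans sS (subsetDl _ _).
- by rewrite in_setU hW orbT.
Qed.

(** Otherwise [c] is the center of a wheel: its rim is [C] without [c], closed up by a path that
    leaves from the other rim neighbour of [c] and returns to [c'] through [a] and [a']. *)
Lemma lobe_attach_indep c c' a a' : c \in C -> c' \in C -> e c c' ->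
  a \in A -> a' \in A -> e c a -> e c' a' -> False.
Proof.
move=> cC c'C ecc' aA a'A eca ec'a'.
have [S [m [eC cS pS [ecm nm mC]]]] := good_open gC cC c'C ecc'.
have [p] := card_gt1_other a' (good_outer gC mC).
rewrite inE => /andP[pH emp] pa.
have [W [pW sW aW]] := lobe_path pH a'A aA pa.
by apply: (rim_wheel gC eC cS pS ecc' ecm nm pW sW emp _ pa aW eca); rewrite symE.
Qed.

(** Some rim edge avoids [c], and its ends cannot both have neighbours in [A]. *)
Lemma unattached_rim_vertex c : c \in C ->
  exists c', [/\ c' \in C, c' != c & forall a, a \in A -> ~~ e c' a].
Proof.
move=> cC.
have [n [S [m [eC cS pS [ecn ecm nm]]]]] := cyc_open symE (good_cyc gC) cC.
have inC z : z \in S -> z \in C /\ z != c.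
  by move=> zS; rewrite eC !inE zS orbT; split=> //; apply: contraNneq cS => <-.
have [[nC nc]] := inC _ (spath_src pS).
case: (spath_inv pS) => [[nm' _]|[k [S' [enk _ eS pS']]]].
  by rewrite nm' eqxx in nm.
have [kC kc] : k \in C /\ k != c by apply: inC; rewrite eS !inE (spath_src pS') orbT.
have [/exists_inP[a aA ena]|/exists_inPn nn] := boolP [exists a in A, e n a]; last by exists n.
exists k; split=> // a' a'A; apply/negP => eka'.
exact: (@lobe_attach_indep n k a a').
Qed.

(** The at least four neighbours of [z] are spread over [C], [A] and [b], which can hold at most
    two, one and one of them. *)
Lemma lobe_leaf z : z \in A -> #|[set u in A | e z u]| <= 1 ->
  [/\ e z b, 0 < #|[set u in A | e z u]| & 1 < #|[set u in C | e z u]|].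
Proof.
move=> zA z1; have [zx zy] := root_free_neq (lobe_x lA) (lobe_y lA) zA.
have [zH zb] := lobe_in zA.
have zU : z \in U by move: zH; rewrite inE => /andP[].
have h4 := rooted_deg rU zU zx zy.
have hle : #|[set u | e z u]| <=
    #|[set u in C | e z u]| + (#|[set u in A | e z u]| + e z b).
  have -> : nat_of_bool (e z b) = #|[set u in [set b] | e z u]|.
    have [ezb|ezb] := boolP (e z b).
      rewrite (_ : [set _ in _ | _] = [set b]) ?cards1 //.
      by apply/setP=> u; rewrite !inE; case: eqP => //= ->.
    rewrite (_ : [set _ in _ | _] = set0) ?cards0 //.
    by apply/setP=> u; rewrite !inE; case: eqP => //= ->; apply: negPf.
  have cU2 (X Y : {set T}) : #|X :|: Y| <= #|X| + #|Y| by rewrite cardsU leq_subr.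
  apply: leq_trans (leq_add (leqnn _) (cU2 _ _)); apply: leq_trans (cU2 _ _).
  apply: subset_leq_card; apply/subsetP => u; rewrite !inE => ezu.
  rewrite ezu !andbT; have [//|uC] := boolP (u \in C) => /=.
  have uH : u \in H by rewrite inE uC (proj2 (edge_in rU ezu)).
  by have := lobe_nbr lA zA uH ezu; rewrite in_setU1 orbC.
have c2 : 1 < #|[set u in C | e z u]|.
  rewrite -(leq_add2r 2); apply: leq_trans h4 (leq_trans hle _).
  by rewrite leq_add2l -[2]/(1 + 1) leq_add // leq_b1.
(* Two rim neighbours of [z] are not adjacent by [lobe_attach_indep], so the rim is not a
   triangle. *)
have C4 : 3 < #|C|.
  case/card_gt1P: (c2) => c1 [c2']; rewrite !inE => -[/andP[c1C ezc1] /andP[c2C ezc2] c12].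
  have [n [S [m [eC cS pS [ecn ecm nm]]]]] := cyc_open symE (good_cyc gC) c1C.
  have inC u : u \in S -> u \in C by rewrite eC !inE orbC => ->.
  have nadj u : u \in S -> e c1 u -> u != c2'.
    move=> uS ecu; apply/eqP => uc2; subst u.
    by apply: (@lobe_attach_indep c1 c2' z z) => //; rewrite symE.
  rewrite eC cardsU1 cS ltnS; apply/card_gt2P; exists n, m, c2'.
  have c2S : c2' \in S by move: c2C; rewrite eC !inE eq_sym (negPf c12).
  split; split=> //; rewrite ?nm ?(spath_src pS) ?(spath_tgt pS) //.
    by apply: nadj => //; apply: spath_tgt pS.
  by rewrite eq_sym; apply: nadj => //; apply: spath_src pS.
have c2' := few_rim_nbrs (good_cyc gC) C4 (AC zA) zx zy.
have : 3 < 2 + (#|[set u in A | e z u]| + e z b).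
  by apply: leq_trans h4 (leq_trans hle _); rewrite leq_add2r.
rewrite -[4]/(2 + 2) leq_add2l => h2; split=> //.
  by move: h2; case: (e z b) => //; rewrite addn0 leqNgt ltnS z1.
by move: h2; case: #|_| => //; case: (e z b).
Qed.

(* Two leaves of a forest on [A] would both be adjacent to [b] and have two
   neighbours on [C]: the first is then the center of a wheel whose rim runs
   through the second, around all of [C], and back to [b] outside [A]. *)
Lemma lobe_cyc : exists2 D, cyc e D & D \subset A.
Proof.
apply: NNPP => noC.
have leaf z0 r : r \in A -> r != z0 ->
    exists z, [/\ z \in A, z != z0 & #|[set u in A | e z u]| <= 1].
  move=> rA rz; apply: NNPP => nl; apply: noC.
  apply: (cyc_of_mindeg symE irrE rA rz) => t tA tz.
  by rewrite ltnNge; apply/negP => ht; apply: nl; exists t.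
have [a0 a0A] := set0Pn _ (lobe_n0 lA).
have [z1 [z1A _ d1]] := leaf b a0 a0A (proj2 (lobe_in a0A)).
have [e1b /card_gt0P[r]] := lobe_leaf z1A d1; rewrite inE => /andP[rA e1r] c1.
have rz1 : r != z1 by apply: contraTneq e1r => ->; rewrite irrE.
have [z2 [z2A z21 d2]] := leaf z1 r rA rz1.
have [e2b _ /ltnW/card_gt0P[t]] := lobe_leaf z2A d2.
rewrite inE => /andP[tC e2t].
have [n [S [m [eC tS pS [etn etm nm]]]]] := cyc_open symE (good_cyc gC) tC.
have mC : m \in C by rewrite eC !inE (spath_tgt pS) orbT.
have [q] := card_gt1_other b (good_outer gC mC); rewrite inE => /andP[qH emq] _.
(* The rim neighbour [t] of [m] is already attached to [A] through [z2]. *)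
have qA : q \notin A.
  by apply/negP => qA; apply: (@lobe_attach_indep t m z2 q) => //; rewrite symE.
have [||W pW sW] := conn_spath lobe_compl_conn (a := q) (b := b).
- by rewrite in_setD qA.
- by rewrite in_setD bA.
have Wout z : z \in W -> z \notin C /\ z \notin A.
  by move/(subsetP sW); rewrite !inE => /and3P[-> ->].
have pC : spath e t C m by rewrite eC; apply: SpathS etn tS pS.
have pCW : spath e t (C :|: W) b.
  by apply: (spath_cat pC emq pW) => z; apply: contraL => /Wout[].
have ACW z : z \in A -> z \notin C :|: W.
  move=> zA; rewrite inE negb_or (AC zA); apply: contraL zA => /Wout[_].
  by [].
have tb : t != b by apply: contraTneq tC => ->; move: bH; rewrite inE => /andP[].
have cR := cyc_close symE pCW (ACW _ z2A) e2t e2b tb.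
have [z1x z1y] := root_free_neq (lobe_x lA) (lobe_y lA) z1A.
apply: noW; exists (z2 |: (C :|: W)), z1; split=> //.
- have [_ [_ [_ _ C3]]] := good_cyc gC.
  rewrite cardsU1 (ACW _ z2A) ltnS; apply: leq_trans C3 _.
  by apply: subset_leq_card; apply: subsetUl.
- by rewrite in_setU1 negb_or eq_sym z21 ACW.
have bC : b \notin [set u in C | e z1 u].
  by move: bH; rewrite !inE => /andP[/negPf->].
have : 2 < #|b |: [set u in C | e z1 u]| by rewrite cardsU1 bC ltnS.
move=> h; apply: leq_trans h _; apply: subset_leq_card; apply/subsetP => u.
rewrite !inE => /orP[/eqP->|/andP[-> ->]]; last by rewrite orbT.
by rewrite e1b (spath_tgt pW) !orbT.
Qed.

(** An unattached rim vertex has a neighbour off [C], necessarily outside [A], which links [C] to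
    the rest. *)
Lemma outside_lobe_conn : conn e (U :\: A).
Proof.
have [c0 [b0 [pC0 _ _]]] := good_cyc gC.
have [c [cC _ cA]] := unattached_rim_vertex (spath_src pC0).
have [u] := card_gt1_other b (good_outer gC cC); rewrite inE => /andP[uH ecu] _.
have uA : u \notin A by apply: contraTN ecu; apply: cA.
have -> : U :\: A = C :|: (H :\: A).
  apply/setP => z; rewrite !inE; have [zC|zC] //= := boolP (z \in C).
  rewrite (subsetP (cyc_sub (good_cyc gC)) z zC) andbT.
  by apply: contraL zC; apply: AC.
apply: (connU (u := c) (v := u)) => //.
- exact: spath_conn pC0.
- exact: lobe_compl_conn.
- by rewrite in_setD uA.
- by rewrite symE.
Qed.

End MinLobe.

(** * Descent from a smallest lobe to a contradiction *)

Lemma lobe_absorb C b A Y z : lobe C b A -> conn e Y -> Y \subset U :\: C ->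
  b \notin Y -> z \in Y -> z \in A -> Y \subset A.
Proof.
move=> lA cY sY bY zY zA; apply: subset_trans (subsetIr Y A).
apply: cY; first exact: subsetIl.
  by apply/set0Pn; exists z; rewrite inE zY.
move=> u v; rewrite !inE => /andP[_ uA] vY euv; rewrite vY /=.
have := lobe_nbr lA uA (subsetP sY v vY) euv; rewrite in_setU1 => /orP[/eqP vb|//].
by move: bY; rewrite -vb vY.
Qed.

(* Take a smallest lobe [A] over all good cycles, a good cycle [C2] inside [A],
   and a lobe [A2] of [C2].  Being at least as large as [A], [A2] reaches
   outside [A]; then it contains [C], since otherwise two vertices would
   separate the graph.  A vertex of [C2] without neighbours in [A2] has a
   neighbour in [A] outside [C2] and [A2], and what is left of [A] there is a
   smaller lobe of [C2]. *)
Lemma no_min_lobe C b A : good C -> min_lobe C b A -> False.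
Proof.
have [k] := ubnP #|A|; elim: k C b A => // k IH C b A hk gC mA.
have lA := proj1 mA.
have smallest C' b' A' : good C' -> lobe C' b' A' -> #|A| <= #|A'|.
  move=> gC' l'; have [b2 [A2 [m2 h2]]] := exists_min_lobe l'.
  rewrite leqNgt; apply/negP => lt; apply: (IH C' b2 A2 _ gC' m2).
  by apply: leq_ltn_trans h2 _; apply: leq_trans lt _; rewrite -ltnS.
have AH a : a \in A -> [/\ a \in U, a \notin C & a != b].
  by move/(subsetP (lobe_sub lA)); rewrite !inE => /and3P[-> -> ->].
have AU : A \subset U by apply/subsetP => a /AH[].
have [bC bU] : b \notin C /\ b \in U by apply/andP; have := lobe_b lA; rewrite inE.
have bA : b \notin A by apply/negP => /AH[_ _]; rewrite eqxx.
have CU := cyc_sub (good_cyc gC).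
pose O := U :\: A.
have inO z : z \in O = (z \in U) && (z \notin A) by rewrite inE andbC.
have xO : x \in O by rewrite inO xU (lobe_x lA).
have yO : y \in O by rewrite inO yU (lobe_y lA).
have cO := outside_lobe_conn gC mA.
have [D cD sD] := lobe_cyc gC mA.
have AO : U :\: O = A.
  by apply/setP => z; rewrite inE inO; have := subsetP AU z; case: (z \in U); case: (z \in A) => // /(_ isT).
have sDO : D \subset U :\: O by rewrite AO.
have [C2 gC2] := good_exists cO (subsetDl _ _) xO yO cD sDO.
rewrite AO => C2A.
have [b2' [A2' l2']] := exists_lobe gC2.
have [b2 [A2 [m2 _]]] := exists_min_lobe l2'.
have l2 := proj1 m2; have leA := smallest _ _ _ gC2 l2.
have A2H a : a \in A2 -> [/\ a \in U, a \notin C2 & a != b2].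
  by move/(subsetP (lobe_sub l2)); rewrite !inE => /and3P[-> -> ->].
have [b2C2 b2U] : b2 \notin C2 /\ b2 \in U by apply/andP; have := lobe_b l2; rewrite inE.
have b2A2 : b2 \notin A2 by apply/negP => /A2H[_ _]; rewrite eqxx.
have OH2 : O \subset U :\: C2.
  apply/subsetP => z; rewrite inO inE => /andP[-> zA]; rewrite andbT.
  by apply: contra zA; apply: (subsetP C2A).
have [_ [_ [_ _ C2_3]]] := good_cyc gC2.
have [c0 [b0 [pC0 _ C_3]]] := good_cyc gC; have c0C := spath_src pC0.
have CO z : z \in C -> z \in O.
  move=> zC; rewrite inO (subsetP CU z zC); apply/negP => /AH[_ zC' _].
  by rewrite zC in zC'.
have HO z : z \in (U :\: C) :\: A -> z \in O by rewrite !inE => /and3P[-> _ ->].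
(* Inside [A], the lobe [A2] would be smaller than [A], since it misses [C2]. *)
have [z1 z1A2 z1A] : exists2 z, z \in A2 & z \notin A.
  apply/subsetPn/negP => sA; move: leA; rewrite leqNgt => /negP; apply.
  apply: proper_card; apply/properP; split=> //.
  have [c [d [pC2 _ _]]] := good_cyc gC2; have cC2 := spath_src pC2.
  by exists c; [apply: (subsetP C2A) | apply/negP => /A2H[_ + _]; rewrite cC2].
have z1O : z1 \in O by rewrite inO z1A andbT; case: (A2H _ z1A2).
(* Otherwise [A2] would absorb the connected set [O], roots included. *)
have b2A : b2 \notin A.
  apply/negP => b2A; have b2O : b2 \notin O by rewrite inO b2A andbF.
  have := subsetP (lobe_absorb l2 cO OH2 b2O z1O z1A2) x xO.
  by apply/negP; apply: lobe_x l2.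
(* If [C] missed [A2], the vertices of [A2] outside [A] other than [b] would be cut off by [b] and
   [b2]. Some exist, since [b |: (A :\: C2)] is too small to contain [A2]. *)
have [z3 z3C z3A2] : exists2 z, z \in C & z \in A2.
  apply: NNPP => nz.
  have CA2 z : z \in C -> z \notin A2 by move=> zC; apply/negP => zA2; apply: nz; exists z.
  have [Z0|nZ] := eqVneq ((A2 :&: O) :\ b) set0.
    have sA2 : A2 \subset b |: (A :\: C2).
      apply/subsetP => z zA2; have := in_set0 z; rewrite -Z0 !inE zA2 /=.
      have [zU zC2 _] := A2H _ zA2.
      by rewrite zC2 zU andbT /=; case: (z == b) => //=; case: (z \in A).
    have := leq_trans leA (subset_leq_card sA2).
    rewrite cardsU1 cardsDS // leqNgt => /negP; apply.
    apply: leq_ltn_trans (_ : 1 + (#|A| - #|C2|) < #|A|).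
      by rewrite leq_add2r leq_b1.
    have le2 := subset_leq_card C2A; rewrite add1n.
    by rewrite -{2}(subnK le2) -addn2 leq_add2l ltnW.
  apply: (no_2cut rU noW minU (p := b) (q := b2) nZ).
  - by apply/subsetP => z; rewrite !inE => /andP[_ /and3P[]].
  - by rewrite !inE (negPf (lobe_x l2)) andbF.
  - by rewrite !inE (negPf (lobe_y l2)) andbF.
  - by rewrite !inE eqxx bU.
  - by rewrite !inE (negPf b2A2) b2U andbF.
  - move=> u v uZ euv; move: uZ; rewrite !inE => /and4P[ub uA2 uA uU'].
    have uH : u \in U :\: C by rewrite inE uU' andbT; apply: contraL uA2; apply: CA2.
    have vA : v \notin A.
      apply/negP => vA; rewrite symE in euv.
      by have := lobe_nbr lA vA uH euv; rewrite in_setU1 (negPf ub) (negPf uA).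
    have vU : v \in U by case: (edge_in rU euv).
    have vO : v \in O by rewrite inO vU.
    have := lobe_nbr l2 uA2 (subsetP OH2 v vO) euv; rewrite in_setU1 => h.
    by rewrite vA vU /=; case: (v == b) => //=; rewrite andbT.
  have [c cC cb2] := card_gt1_other b2 (ltnW C_3).
  exists c; first exact: (subsetP CU).
  rewrite !inE (negPf cb2) (negPf (CA2 c cC)) andbF !orbF.
  by apply: contraNneq bC => <-.
have COs : C \subset U :\: C2 by apply: subset_trans OH2; apply/subsetP.
(* Otherwise [A2] absorbs the path [C] minus [b2]. An unattached vertex of it leads to [h] outside
   [C] and [A], whence [A2] absorbs all of that complement, with the root [x]. *)
have b2C : b2 \notin C.
  apply/negP => b2C.
  have [n [S [m [eC b2S pS _]]]] := cyc_open symE (good_cyc gC) b2C.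
  have z3S : z3 \in S.
    by have [_ _] := A2H _ z3A2; move: z3C; rewrite eC !inE => /orP[->|].
  have SH2 : S \subset U :\: C2 by apply: subset_trans COs; rewrite eC subsetUr.
  have SA2 := lobe_absorb l2 (spath_conn symE pS) SH2 b2S z3S z3A2.
  have [c [cC cb2 cA]] := unattached_rim_vertex gC mA b2C.
  have cA2 : c \in A2.
    by apply: (subsetP SA2); move: cC; rewrite eC !inE (negPf cb2).
  have [h] := card_gt1_other b (good_outer gC cC); rewrite inE => /andP[hH ech] _.
  have hA : h \notin A by apply: contraTN ech; apply: cA.
  have hHA : h \in (U :\: C) :\: A by rewrite in_setD hA.
  have hC : h \notin C by move: hH; rewrite inE => /andP[].
  have hA2 : h \in A2.
    have := lobe_nbr l2 cA2 (subsetP OH2 h (HO h hHA)) ech.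
    by rewrite in_setU1 => /orP[/eqP hb2|//]; move: hC; rewrite hb2 b2C.
  have HAs : (U :\: C) :\: A \subset U :\: C2.
    by apply: subset_trans OH2; apply/subsetP.
  have b2H : b2 \notin (U :\: C) :\: A by rewrite !inE b2C andbF.
  have := subsetP (lobe_absorb l2 (lobe_compl_conn gC mA) HAs b2H hHA hA2) x.
  rewrite !inE (lobe_x lA) (good_x gC) xU => /(_ isT).
  by apply/negP; apply: lobe_x l2.
have CA2 : C \subset A2 := lobe_absorb l2 (spath_conn symE pC0) COs b2C z3C z3A2.
have [c2 c2C2] : exists c, c \in C2.
  by have [c [d [p _ _]]] := good_cyc gC2; exists c; apply: spath_src p.
have [c [cC2 _ cA2]] := unattached_rim_vertex gC2 m2 c2C2.
have [m] := card_gt1_other b (good_outer gC2 cC2); rewrite inE => /andP[mH2 ecm] mb.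
have mA2 : m \notin A2 by apply: contraTN ecm; apply: cA2.
have cA := subsetP C2A c cC2.
have [mC2 mU] : m \notin C2 /\ m \in U by apply/andP; move: mH2; rewrite inE.
have mA' : m \in A.
  have mH : m \in U :\: C by rewrite inE mU andbT; apply: contra mA2; apply: (subsetP CA2).
  by have := lobe_nbr lA cA mH ecm; rewrite in_setU1 (negPf mb).
pose M := (A :\: C2) :\: A2.
have inM z : z \in M = [&& z \notin A2, z \notin C2 & z \in A] by rewrite !inE.
have MA : M \subset A by apply/subsetP => z; rewrite inM => /and3P[].
(* An edge from [M] to [A2] would start at [b2], which is not in [A]. As [A2] contains [C], edges
   leaving [M] off [C2] can lead only to [b]. *)
have lM : lobe C2 b M.
  split.
  - by rewrite inE bU andbT; apply: contra bA; apply: (subsetP C2A).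
  - by apply/set0Pn; exists m; rewrite inM mA2 mC2.
  - apply/subsetP => z; rewrite inM => /and3P[_ zC2 /AH[zU _ zb]].
    by rewrite !inE zb zC2.
  - by apply: contra (lobe_x lA); apply: (subsetP MA).
  - by apply: contra (lobe_y lA); apply: (subsetP MA).
  move=> u v; rewrite inM => /and3P[uA2 uC2 uA] vH2 euv.
  have uH2 : u \in U :\: C2 by rewrite inE uC2; case: (AH u uA).
  have vA2 : v \notin A2.
    apply/negP => vA2; rewrite symE in euv.
    have := lobe_nbr l2 vA2 uH2 euv; rewrite in_setU1 (negPf uA2) orbF => /eqP ub2.
    by move: b2A; rewrite -ub2 uA.
  move: vH2; rewrite inE => /andP[vC2 vU].
  have vH : v \in U :\: C by rewrite inE vU andbT; apply: contra vA2; apply: (subsetP CA2).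
  have := lobe_nbr lA uA vH euv; rewrite !in_setU1 => /orP[->//|vA].
  by rewrite inM vA2 vC2 vA orbT.
have := smallest _ _ _ gC2 lM; rewrite leqNgt => /negP; apply.
apply: proper_card; apply/properP; split=> //.
by exists c => //; rewrite inM cC2 andbF.
Qed.

(** Deleting the roots costs every other vertex at most two of its four neighbours. *)
Lemma rooted_cyc : exists2 C, cyc e C & C \subset U :\: [set x; y].
Proof.
have [z [zU zx zy]] := rooted_ex rU.
have zR : z \in U :\: [set x; y] by rewrite !inE negb_or zx zy.
apply: (cyc_of_mindeg symE irrE zR zx) => r; rewrite !inE negb_or.
move=> /andP[/andP[rx ry] rU'] _; have h4 := rooted_deg rU rU' rx ry.
have h : #|[set u | e r u]| <=
    #|[set x; y]| + #|[set u in U :\: [set x; y] | e r u]|.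
  rewrite -cardsUI; apply: leq_trans (leq_addr _ _).
  apply: subset_leq_card; apply/subsetP => u; rewrite !inE => eru.
  by rewrite eru (proj2 (edge_in rU eru)) !andbT orbN.
rewrite -(leq_add2l 2); apply: leq_trans h4 (leq_trans h _).
by rewrite leq_add2r cards2; case: (_ != _).
Qed.

Lemma no_minimal_rooted : False.
Proof.
have [C cC sC] := rooted_cyc.
have cxy : conn e [set x; y].
  case: xy => [->|exy]; first by rewrite setUid; apply: conn1.
  apply: (connU (u := x) (v := y)); rewrite ?inE //; try exact: conn1.
  by rewrite symE.
have sxy : [set x; y] \subset U by rewrite subUset !sub1set xU.
have [||C' gC' _] := good_exists cxy sxy _ _ cC sC; rewrite ?inE ?eqxx ?orbT //.
have [b [A l]] := exists_lobe gC'.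
have [b' [A' [m _]]] := exists_min_lobe l.
exact: no_min_lobe gC' m.
Qed.

End Lobes.

Lemma rooted_wheel (T : finType) (e : rel T) (U : {set T}) (x y : T) :
  rooted e U x y -> has_rooted_wheel e x y.
Proof.
have [k] := ubnP #|U|; elim: k e U x y => // k IH e U x y hk rU.
apply: NNPP => noW; apply: (no_minimal_rooted rU noW) => e' U' x' y' lt.
by apply: IH; apply: leq_trans lt _; rewrite -ltnS.
Qed.

(** * From the degree claim to greedy 4-coloring *)

Section Coloring.

Variables (T : finType) (e : rel T).
Hypotheses (symE : symmetric e) (irrE : irreflexive e).
Implicit Types (a b v x y z : T) (C S U : {set T}).

Lemma spath_seq a S b : spath e a S b ->
  exists s, [/\ path e a s, last a s = b, uniq (a :: s) & a :: s =i S].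
Proof.
elim=> [{}a|{}a c {}S {}b eac aS pS [s [ps ls us es]]].
  by exists [::]; split=> // z; rewrite !inE.
exists (c :: s); split=> //.
- by rewrite /= eac.
- by rewrite cons_uniq es aS us.
- by move=> z; rewrite in_cons es !inE.
Qed.

Lemma long_wheel_of_rooted (e' : rel T) x y : subrel e' e ->
  has_rooted_wheel e' x y -> has_long_wheel e.
Proof.
move=> ee [C [v [cC C4 vC _ v3]]].
have [a [b [pC eba C3]]] := cyc_transfer cC (fun u w _ _ => ee u w).
have [s [ps ls us es]] := spath_seq pC.
have sz : size (a :: s) = #|C| by rewrite -(card_uniqP us); apply: eq_card.
exists (a :: s), v; apply/andP; split; last by rewrite sz.
apply/and3P; split; first apply/andP; first split.
- by rewrite sz.
- by rewrite /ucycleb us andbT /= rcons_path ps ls.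
- by rewrite es.
apply: leq_trans v3 _; apply: subset_leq_card; apply/subsetP => u.
by rewrite !inE -in_cons es => /andP[-> /ee].
Qed.

Hypothesis noW : ~ has_long_wheel e.

(** Otherwise the subgraph induced on [U], with both roots at one vertex, satisfies the hypotheses
    of [rooted_wheel]. *)
Lemma small_degree U : U != set0 ->
  exists2 z, z \in U & #|[set u in U | e z u]| <= 3.
Proof.
case/set0Pn=> z0 z0U; apply: NNPP => big.
have deg z : z \in U -> 3 < #|[set u in U | e z u]|.
  by move=> zU; rewrite ltnNge; apply/negP => h; apply: big; exists z.
pose eU := [rel a b | [&& a \in U, b \in U & e a b]].
apply: noW; apply: (@long_wheel_of_rooted eU z0 z0); first by move=> a b /and3P[].
apply: (@rooted_wheel _ _ U); split=> //.
- by move=> a b /=; rewrite symE andbCA.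
- by move=> a /=; rewrite irrE !andbF.
- by move=> a b /and3P[].
- by left.
- have /card_gt0P[z] : 0 < #|[set u in U | e z0 u]| by apply: leq_trans (deg _ z0U).
  rewrite inE => /andP[zU ez]; have zz0 : z != z0 by apply: contraTneq ez => ->; rewrite irrE.
  by exists z.
- move=> z zU _ _; apply: leq_trans (deg z zU) _; apply: subset_leq_card.
  by apply/subsetP => u; rewrite !inE /= zU.
Qed.

Lemma color_subset U : exists f : T -> 'I_4,
  forall a b, a \in U -> b \in U -> e a b -> f a != f b.
Proof.
have [k] := ubnP #|U|; elim: k U => // k IH U hk.
have [->|nU] := eqVneq U set0; first by exists (fun=> ord0) => a b; rewrite inE.
have [z zU z3] := small_degree nU.
have [|f hf] := IH (U :\ z).
  by move: hk; rewrite (cardsD1 z) zU.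
(* The at most three neighbours of [z] in [U] leave one of the four colors free. *)
have [c cN] : exists c, c \notin f @: [set u in U | e z u].
  apply: NNPP => all; have : 4 <= #|f @: [set u in U | e z u]|.
    rewrite -{1}(card_ord 4) subset_leq_card //; apply/subsetP => c _.
    by apply/negPn/negP => cN; apply: all; exists c.
  by rewrite leqNgt => /negP; apply; apply: leq_ltn_trans (leq_imset_card _ _) _.
have cu u : u \in U -> e z u -> c != f u.
  by move=> uU ezu; apply: contraNneq cN => ->; apply: imset_f; rewrite inE uU.
exists (fun w => if w == z then c else f w) => a b aU bU eab.
case: (eqVneq a z) => [az|az]; case: (eqVneq b z) => [bz|bz].
- by rewrite az bz irrE in eab.
- by apply: cu; rewrite // -az.
- by rewrite eq_sym; apply: cu; rewrite // -bz symE.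
- by apply: hf; rewrite ?inE ?az ?bz.
Qed.

End Coloring.

Theorem theorem8p2 (T : finType) (e : rel T) (he : simple_graph e)
  (hlw : ~ has_long_wheel e) : colorable e 4.
Proof.
have [symE irrE] := he.
have [f hf] := color_subset symE irrE hlw [set: T].
by exists f => x y; apply: hf.
Qed.
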